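(* Let $p,q:[a,\infty)\to(0,\infty)$ be continuous, $a\ge 0$, and consider the equation (A): $(p(t)x')'=q(t)x$. Assume that $\int_a^\infty\frac{dt}{p(t)}<\infty$ and $\int_a^\infty q(t)\,dt=\infty$, and put $\pi(t)=\int_t^\infty\frac{ds}{p(s)}$, $Q(t)=\int_a^t q(s)\,ds$. Suppose that $$\int_a^\infty q(t)\pi(t)\,dt=\infty\qquad\Bigl(\text{or equivalently } \int_a^\infty\frac{Q(t)}{p(t)}\,dt=\infty\Bigr)$$ and that there is a constant $\delta\in(0,1)$ such that $$\int_a^t\frac{Q(s)^2}{p(s)}\,ds\le\delta Q(t)\quad\text{for all large } t.$$ Then (A) possesses a positive growing extreme solution $x(t)$, i.e. a positive solution satisfying $x(\infty)=Dx(\infty)=\infty$.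
   Context: Solutions of (A) are nontrivial real solutions defined on some interval $[T,\infty)$, $T\ge a$. $Dx(t)=p(t)x'(t)$, $x(\infty)=\lim_{t\to\infty}x(t)$, $Dx(\infty)=\lim_{t\to\infty}Dx(t)$. A solution is extreme if either $|x(\infty)|=|Dx(\infty)|=0$ (decaying) or $|x(\infty)|=|Dx(\infty)|=\infty$ (growing). *)

(* Defs.v *)
From Stdlib Require Import Reals Lra.
From Coquelicot Require Import Coquelicot.
Open Scope R_scope.

Definition half_line (a : R) : R -> Prop := fun t => a <= t.

(* Derivative relative to [D]: on [half_line T] it is the usual two-sided
   derivative at interior points and the right derivative at [T], so that
   values of [f] to the left of [T] are irrelevant. *)
Definition is_derive_within (D : R -> Prop) (f : R -> R) (t l : R) : Prop :=
  filterdiff f (within D (locally t)) (fun y : R => scal y l).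

(* int_a^oo f = oo; Coquelicot's improper integral only takes finite values. *)
Definition RInt_diverges (f : R -> R) (a : R) : Prop :=
  is_lim (fun t => RInt f a t) p_infty p_infty.

Definition tail_int (p : R -> R) (t : R) : R :=
  RInt_gen (fun s => / p s) (at_point t) (Rbar_locally p_infty).

Definition QQ (q : R -> R) (a t : R) : R := RInt q a t.

(* The quasi-derivative p x', where [x'] is the derivative of the function. *)
Definition quasi_deriv (p x' : R -> R) (t : R) : R := p t * x' t.

(* Nontrivial solution x of (p x')' = q x on [T,oo), with derivative [x']. *)
Definition is_solution (a : R) (p q : R -> R) (T : R) (x x' : R -> R) : Prop :=
  a <= T /\
  (forall t, T <= t -> is_derive_within (half_line T) x t (x' t)) /\
  (forall t, T <= t ->
     is_derive_within (half_line T) (quasi_deriv p x') t (q t * x t)) /\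
  (exists t, T <= t /\ x t <> 0).

(* Growing extreme: |x(oo)| = |(p x')(oo)| = oo, both limits existing in Rbar. *)
Definition is_growing_extreme (p x x' : R -> R) : Prop :=
  exists l m : Rbar,
    is_lim x p_infty l /\ is_lim (quasi_deriv p x') p_infty m /\
    Rbar_abs l = p_infty /\ Rbar_abs m = p_infty.

(* Main.v *)
Require Import Defs.
From Stdlib Require Import Reals Lra.
From Coquelicot Require Import Coquelicot.
Open Scope R_scope.

(** Write the equation as the first-order system [x' = y/p], [y' = q x], where
    [y = p x'] is the quasi-derivative.  Its solution with [x a = 1] and
    [y a = 0] is already a growing extreme one.  Indeed
    [(x y)' = y^2/p + q x^2 >= 0] gives [x y >= 0] on [a,oo), hence
    [(x^2)' = 2 x y / p >= 0] and [x^2 >= 1]; by continuity [x >= 1].  Now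
    [y' = q x >= q] yields [y >= Q], and then [x' = y/p >= Q/p] yields
    [x >= int_a Q/p].  Since [Q] and [int_a Q/p] both tend to infinity, so do [y]
    and [x] ([system_lower_bounds]).

    The two divergence conditions are compared by parts: with
    [pi(t) = int_t^oo 1/p], [(Q pi)' = q pi - Q/p], so
    [int_a^t q pi = Q(t) pi(t) + int_a^t Q/p].  The boundary term is nonnegative,
    which settles one direction; for the other, [Q] is nondecreasing, so
    [int_a^u Q/p >= int_a^t Q/p + Q(t) (pi(t) - pi(u)) = int_a^t q pi - Q(t) pi(u)]
    for [u >= t], and the last term vanishes as [u] tends to infinity
    ([RInt_diverges_tail_iff]).

    The solution on the whole half-line comes from the Picard series of the
    linear system: its n-th term is bounded on compact sets by the n-th term of
    an exponential series, and so it may be differentiated termwise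
    ([linear_system_solution]).  To deal with two-sided derivatives only, [p] and
    [q] are first extended to the left of [a] by their values at [a]. *)

(** * Integrals of continuous functions *)

Lemma is_derive_continuous (f : R -> R) (t l : R) :
  is_derive f t l -> continuous f t.
Proof.
  intros H; apply (ex_derive_continuous (K := R_AbsRing) (V := R_NormedModule)).
  now exists l.
Qed.

Lemma is_derive_RInt_continuous (f : R -> R) (a t : R) :
  (forall s, continuous f s) -> is_derive (fun u => RInt f a u) t (f t).
Proof.
  intros cf. apply (is_derive_RInt f _ a t); [|apply cf].
  apply filter_forall; intros u.
  apply (RInt_correct (V := R_CompleteNormedModule)), ex_RInt_continuous.
  intros; apply cf.
Qed.

Lemma continuous_RInt (f : R -> R) (a t : R) :
  (forall s, continuous f s) -> continuous (fun u => RInt f a u) t.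
Proof.
  intros cf. exact (is_derive_continuous _ _ _ (is_derive_RInt_continuous f a t cf)).
Qed.

Lemma RInt_empty (f : R -> R) (a : R) : RInt f a a = 0.
Proof. apply (RInt_point (V := R_CompleteNormedModule)). Qed.

Lemma is_derive_product (f g : R -> R) (s f' g' : R) :
  is_derive f s f' -> is_derive g s g' ->
  is_derive (fun u => f u * g u) s (f' * g s + f s * g').
Proof.
  intros Hf Hg.
  apply (is_derive_mult (K := R_AbsRing) f g s f' g' Hf Hg Rmult_comm).
Qed.

(** Comparing two functions, rather than one function with 0, covers both the
    lower bounds on the solution and, used in both directions, the equality of
    two functions with the same derivative. *)
Lemma derive_le_incr (f f' g g' : R -> R) (a t : R) :
  a <= t ->
  (forall s, is_derive f s (f' s)) -> (forall s, is_derive g s (g' s)) ->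
  (forall s, a <= s -> f' s <= g' s) -> f t - f a <= g t - g a.
Proof.
  intros Hat Hf Hg Hle.
  assert (Hd : forall s, is_derive (fun u => g u - f u) s (g' s - f' s)).
  { intros s. now apply (is_derive_minus (K := R_AbsRing) (V := R_NormedModule)). }
  destruct (MVT_gen (fun u => g u - f u) a t (fun s => g' s - f' s))
    as [c [Hc E]].
  - intros; apply Hd.
  - intros s _. apply continuity_pt_filterlim.
    exact (is_derive_continuous _ _ _ (Hd s)).
  - rewrite Rmin_left in Hc by lra. specialize (Hle c (proj1 Hc)). nra.
Qed.

Lemma RInt_continuous_incr (f : R -> R) (a s t : R) :
  (forall u, continuous f u) -> (forall u, a <= u -> 0 <= f u) ->
  a <= s -> s <= t -> RInt f a s <= RInt f a t.
Proof.
  intros cf pf Has Hst.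
  assert (H : 0 - 0 <= RInt f a t - RInt f a s).
  { apply (derive_le_incr (fun _ => 0) (fun _ => 0) _ f s t Hst).
    - intros u. exact (is_derive_const (K := R_AbsRing) (V := R_NormedModule) 0 u).
    - intros u. now apply is_derive_RInt_continuous.
    - intros u Hu. apply pf. lra. }
  lra.
Qed.

Lemma RInt_le_limit (f : R -> R) (a t I : R) :
  (forall u, continuous f u) -> (forall u, a <= u -> 0 <= f u) ->
  is_lim (fun u => RInt f a u) p_infty I -> a <= t -> RInt f a t <= I.
Proof.
  intros cf pf HI Ht.
  apply (is_lim_le_loc (fun _ => RInt f a t) (fun u => RInt f a u) p_infty
           (RInt f a t) I).
  - exists t. intros u Hu. apply RInt_continuous_incr; auto; lra.
  - apply is_lim_const.
  - exact HI.
Qed.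

(** * Existence for linear systems *)

(** Rescaling the integral to [0,1] treats [t < a] and [t >= a] alike: the
    bound becomes the integral of a multiple of [y^n] over [0,1]. *)
Lemma Rabs_RInt_le_power (f : R -> R) (a t K : R) (n : nat) :
  (forall s, continuous f s) ->
  (forall s, Rabs (s - a) <= Rabs (t - a) -> Rabs (f s) <= K * Rabs (s - a) ^ n) ->
  Rabs (RInt f a t) <= K * Rabs (t - a) ^ S n / INR (S n).
Proof.
  intros cf Hf.
  set (u := t - a) in *.
  assert (cg : forall y, continuous (fun y => u * f (u * y + a)) y).
  { intros y. apply (continuous_scal_r (K := R_AbsRing) (V := R_NormedModule) u
      (fun y => f (u * y + a))).
    apply (continuous_comp (fun y => u * y + a) f); [|apply cf].
    apply (ex_derive_continuous (K := R_AbsRing) (V := R_NormedModule)).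
    auto_derive; easy. }
  assert (E : RInt (fun y => u * f (u * y + a)) 0 1 = RInt f a t).
  { transitivity (RInt f (u * 0 + a) (u * 1 + a)).
    - apply (RInt_comp_lin (V := R_CompleteNormedModule) f u a 0 1).
      apply ex_RInt_continuous; intros; apply cf.
    - f_equal; unfold u; ring. }
  rewrite <- E.
  assert (HnS : INR (S n) <> 0) by (apply not_0_INR; discriminate).
  assert (Hg : is_RInt (fun y => K * Rabs u ^ S n * y ^ n) 0 1
     (minus (K * Rabs u ^ S n / INR (S n) * 1 ^ S n)
            (K * Rabs u ^ S n / INR (S n) * 0 ^ S n))).
  { apply (is_RInt_derive (V := R_CompleteNormedModule)
      (fun y => K * Rabs u ^ S n / INR (S n) * y ^ S n)).
    - intros y _. auto_derive; [easy|].
      change (Rabs u * Rabs u ^ n) with (Rabs u ^ S n). fold (INR (S n)).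
      field. exact HnS.
    - intros y _. apply (ex_derive_continuous (K := R_AbsRing) (V := R_NormedModule)).
      auto_derive; easy. }
  replace (K * Rabs u ^ S n / INR (S n)) with
    (minus (K * Rabs u ^ S n / INR (S n) * 1 ^ S n)
            (K * Rabs u ^ S n / INR (S n) * 0 ^ S n)).
  2:{ unfold minus, plus, opp; simpl. rewrite pow1. field. exact HnS. }
  refine (norm_RInt_le (V := R_NormedModule) _ _ 0 1 _ _ Rle_0_1 _ _ Hg).
  2:{ apply (RInt_correct (V := R_CompleteNormedModule)), ex_RInt_continuous.
      intros; apply cg. }
  intros y Hy. change (Rabs (u * f (u * y + a)) <= K * Rabs u ^ S n * y ^ n).
  rewrite Rabs_mult.
  assert (Ha : Rabs (u * y + a - a) = Rabs u * y).
  { replace (u * y + a - a) with (u * y) by ring.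
    rewrite Rabs_mult, (Rabs_pos_eq y); lra. }
  specialize (Hf (u * y + a)). rewrite Ha in Hf.
  pose proof (Rabs_pos u) as Hu.
  assert (H : Rabs u * y <= Rabs u) by nra.
  specialize (Hf H). rewrite Rpow_mult_distr in Hf.
  apply Rle_trans with (Rabs u * (K * (Rabs u ^ n * y ^ n))).
  - now apply Rmult_le_compat_l.
  - simpl. right; ring.
Qed.

Lemma continuous_bounded_near (f : R -> R) (a M : R) :
  (forall t, continuous f t) ->
  {L : R | forall t, Rabs (t - a) <= M -> Rabs (f t) <= L}.
Proof.
  intros cf.
  destruct (bounded_continuity (V := R_NormedModule) f (a - M) (a + M)) as [L HL].
  { intros t _; apply cf. }
  exists L. intros t Ht. apply Rabs_le_between in Ht. left. apply HL. lra.
Qed.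

Lemma ex_series_exp_coef (C z : R) :
  ex_series (fun n => C * z ^ n / INR (Factorial.fact n)).
Proof.
  apply ex_series_ext with
    (fun n => scal C (scal (pow_n z n) (/ INR (Factorial.fact n)))).
  - intros n. rewrite pow_n_pow. unfold scal; simpl; unfold mult; simpl.
    unfold Rdiv. ring.
  - apply (ex_series_scal (K := R_AbsRing) (V := R_NormedModule)).
    exists (exp z). apply is_exp_Reals.
Qed.

Lemma CVN_r_majorant (g : nat -> R -> R) (r : posreal) (m : nat -> R) :
  ex_series m -> (forall n t, Rabs t < r -> Rabs (g n t) <= m n) -> CVN_r g r.
Proof.
  intros Hm Hg. exists m, (Series m).
  assert (Hr : Rabs 0 < r) by (rewrite Rabs_R0; apply cond_pos).
  split.
  - apply is_lim_seq_Reals. apply is_lim_seq_ext with (sum_n m).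
    + intros n. rewrite sum_n_Reals. apply sum_eq. intros i _.
      rewrite Rabs_pos_eq; auto.
      exact (Rle_trans _ _ _ (Rabs_pos _) (Hg i 0 Hr)).
    + exact (Series_correct _ Hm).
  - intros n t Ht. apply Hg. unfold Boule in Ht. now rewrite Rminus_0_r in Ht.
Qed.

(** Normal convergence of the derivatives on the ball of radius [|t| + 1] around
    0 gives their uniform convergence near [t]; with pointwise convergence of the
    series itself this allows termwise differentiation. *)
Lemma is_derive_Series_CVN (f g : nat -> R -> R) (t : R) :
  (forall n s, is_derive (f n) s (g n s)) ->
  (forall s, ex_series (fun n => f n s)) ->
  (forall r, CVN_r g r) ->
  is_derive (fun s => Series (fun n => f n s)) t (Series (fun n => g n t)).
Proof.
  intros Hd Hs Hr.
  assert (Hp : 0 < Rabs t + 1) by (pose proof (Rabs_pos t); lra).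
  destruct (CVN_CVU_r g (mkposreal _ Hp) (Hr _) t) as [e He].
  { simpl; lra. }
  apply is_derive_Reals.
  apply (CVU_derivable (SP f) (SP g) (fun s => Series (fun n => f n s))
    (fun s => Series (fun n => g n s)) t e He).
  - intros s _. apply is_lim_seq_Reals.
    apply is_lim_seq_ext with (sum_n (fun n => f n s)).
    { intros n. apply sum_n_Reals. }
    exact (Series_correct _ (Hs s)).
  - intros n s _. apply is_derive_Reals. unfold SP.
    apply is_derive_ext with (fun u => sum_n (fun k => f k u) n).
    { intros u. apply sum_n_Reals. }
    rewrite <- sum_n_Reals.
    apply (is_derive_sum_n (K:=R_AbsRing) (V:=R_NormedModule)). intros; apply Hd.
  - unfold Boule. rewrite Rminus_diag, Rabs_R0. apply cond_pos.
Qed.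

(** The n-th term of the Picard series of [x' = A y], [y' = B x] with initial
    values [(x0, y0)] at [a]; the n-th Picard iterate is the sum of the terms up
    to n. *)
Fixpoint picard (A B : R -> R) (a x0 y0 : R) (n : nat) : (R -> R) * (R -> R) :=
  match n with
  | O => (fun _ => x0, fun _ => y0)
  | S n => let v := picard A B a x0 y0 n in
           (fun t => RInt (fun s => A s * snd v s) a t,
            fun t => RInt (fun s => B s * fst v s) a t)
  end.

Lemma picard_continuous (A B : R -> R) (a x0 y0 : R) (n : nat) :
  (forall t, continuous A t) -> (forall t, continuous B t) ->
  (forall t, continuous (fst (picard A B a x0 y0 n)) t) /\
  (forall t, continuous (snd (picard A B a x0 y0 n)) t).
Proof.
  intros cA cB. induction n as [|n [IH1 IH2]].
  - split; intros; apply continuous_const.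
  - split; intros t; eapply is_derive_continuous; simpl;
      apply is_derive_RInt_continuous; intros s;
      now apply (continuous_mult (K := R_AbsRing)).
Qed.

(** Each step integrates once, so [n] steps multiply the bound by
    [(L |t - a|)^n / n!]; the two components share the bound because each is
    computed from the other. *)
Lemma picard_bound (A B : R -> R) (a x0 y0 L M : R) (n : nat) :
  (forall t, continuous A t) -> (forall t, continuous B t) ->
  (forall t, Rabs (t - a) <= M -> Rabs (A t) <= L /\ Rabs (B t) <= L) ->
  forall t, Rabs (t - a) <= M ->
  Rabs (fst (picard A B a x0 y0 n) t)
    <= (Rabs x0 + Rabs y0) * L ^ n / INR (Factorial.fact n) * Rabs (t - a) ^ n /\
  Rabs (snd (picard A B a x0 y0 n) t)
    <= (Rabs x0 + Rabs y0) * L ^ n / INR (Factorial.fact n) * Rabs (t - a) ^ n.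
Proof.
  intros cA cB HL.
  set (C := Rabs x0 + Rabs y0).
  induction n as [|n IH]; intros t Ht.
  - simpl. pose proof (Rabs_pos x0); pose proof (Rabs_pos y0). unfold C. lra.
  - set (K := C * L ^ n / INR (Factorial.fact n)) in *.
    assert (HS : C * L ^ S n / INR (Factorial.fact (S n)) * Rabs (t - a) ^ S n
                 = L * K * Rabs (t - a) ^ S n / INR (S n)).
    { unfold K. rewrite fact_simpl, mult_INR. simpl pow. field.
      split; [apply INR_fact_neq_0 | apply not_0_INR; discriminate]. }
    rewrite HS.
    destruct (picard_continuous A B a x0 y0 n cA cB) as [c1 c2].
    assert (Hm : forall c v s, Rabs c <= L -> Rabs v <= K * Rabs (s - a) ^ n ->
              Rabs (c * v) <= L * K * Rabs (s - a) ^ n).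
    { intros c v s Hc Hv. rewrite Rabs_mult, Rmult_assoc.
      apply Rmult_le_compat; auto using Rabs_pos. }
    split; cbn [picard fst snd]; apply Rabs_RInt_le_power.
    + intros s. now apply (continuous_mult (K := R_AbsRing)).
    + intros s Hs. apply Hm; [apply HL | apply IH]; lra.
    + intros s. now apply (continuous_mult (K := R_AbsRing)).
    + intros s Hs. apply Hm; [apply HL | apply IH]; lra.
Qed.

(** The bounds of [picard_bound] at the edge [|t - a| = M] serve on the whole
    interval: they no longer depend on [t] and are summable. *)
Lemma picard_majorant (A B : R -> R) (a x0 y0 M : R) :
  (forall t, continuous A t) -> (forall t, continuous B t) ->
  {K | forall t, Rabs (t - a) <= M ->
    Rabs (A t) <= K /\ Rabs (B t) <= K /\
    forall n,
      Rabs (fst (picard A B a x0 y0 n) t)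
        <= (Rabs x0 + Rabs y0) * (K * M) ^ n / INR (Factorial.fact n) /\
      Rabs (snd (picard A B a x0 y0 n) t)
        <= (Rabs x0 + Rabs y0) * (K * M) ^ n / INR (Factorial.fact n)}.
Proof.
  intros cA cB. set (C := Rabs x0 + Rabs y0).
  destruct (continuous_bounded_near A a M cA) as [L1 H1].
  destruct (continuous_bounded_near B a M cB) as [L2 H2].
  set (K := Rmax L1 L2).
  assert (HK : forall t, Rabs (t - a) <= M -> Rabs (A t) <= K /\ Rabs (B t) <= K).
  { intros t Ht. split.
    - eapply Rle_trans; [now apply H1 | apply Rmax_l].
    - eapply Rle_trans; [now apply H2 | apply Rmax_r]. }
  exists K. intros t Ht.
  destruct (HK t Ht) as [HA HB]. split; [exact HA|]. split; [exact HB|].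
  intros n.
  destruct (picard_bound A B a x0 y0 K M n cA cB HK t Ht) as [Hu Hv].
  fold C in Hu, Hv.
  assert (HC : 0 <= C * K ^ n / INR (Factorial.fact n)).
  { apply Rmult_le_pos; [apply Rmult_le_pos|].
    - unfold C; pose proof (Rabs_pos x0); pose proof (Rabs_pos y0); lra.
    - apply pow_le. exact (Rle_trans _ _ _ (Rabs_pos _) HA).
    - left. apply Rinv_0_lt_compat, INR_fact_lt_0. }
  assert (HM : C * K ^ n / INR (Factorial.fact n) * Rabs (t - a) ^ n <=
               C * (K * M) ^ n / INR (Factorial.fact n)).
  { rewrite Rpow_mult_distr.
    apply Rle_trans with (C * K ^ n / INR (Factorial.fact n) * M ^ n).
    - apply Rmult_le_compat_l; [exact HC|]. apply pow_incr.
      split; [apply Rabs_pos | exact Ht].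
    - right. unfold Rdiv. ring. }
  split; eapply Rle_trans; [exact Hu | exact HM | exact Hv | exact HM].
Qed.

(** The factor [c] is kept apart because the limit equation has to be read off
    as [x' = c y] with [y] the sum of the [w n]. *)
Lemma is_derive_Series_linear (c : R -> R) (f w : nat -> R -> R) (t s0 : R) :
  (forall n s, is_derive (f n) s (c s * w n s)) ->
  (forall s, ex_series (fun n => f n s)) ->
  (forall r, CVN_r (fun n s => c s * w n s) r) ->
  is_derive (fun s => s0 + Series (fun n => f n s)) t
            (c t * Series (fun n => w n t)).
Proof.
  intros Hd Hs Hr. rewrite <- Series_scal_l, <- (Rplus_0_l (Series _)).
  apply (is_derive_plus (K := R_AbsRing) (V := R_NormedModule)).
  - exact (is_derive_const (K := R_AbsRing) (V := R_NormedModule) s0 t).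
  - now apply (is_derive_Series_CVN f (fun n s => c s * w n s)).
Qed.

Lemma Series_zero (w : nat -> R) : (forall n, w n = 0) -> Series w = 0.
Proof.
  intros Hw. rewrite (Series_ext w (fun n => 0 * w n)).
  - rewrite Series_scal_l. ring.
  - intros n. rewrite (Hw n). ring.
Qed.

(** The series without their constant terms are differentiated termwise:
    [u (S n)' = A (v n)] turns the derivative of [x0 + sum_n u (S n)] into
    [A] times the full series [sum_n v n], which is [y]; likewise for [y]. *)
Lemma linear_system_solution (A B : R -> R) (a x0 y0 : R) :
  (forall t, continuous A t) -> (forall t, continuous B t) ->
  exists x y : R -> R, x a = x0 /\ y a = y0 /\
    (forall t, is_derive x t (A t * y t)) /\
    (forall t, is_derive y t (B t * x t)).
Proof.
  intros cA cB.
  set (u := fun n => fst (picard A B a x0 y0 n)).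
  set (v := fun n => snd (picard A B a x0 y0 n)).
  set (C := Rabs x0 + Rabs y0).
  assert (bnd := fun M => picard_majorant A B a x0 y0 M cA cB).
  fold C in bnd.
  assert (sum : forall t, ex_series (fun n => u n t) /\ ex_series (fun n => v n t)).
  { intros t. destruct (bnd (Rabs (t - a))) as [K HK].
    destruct (HK t (Rle_refl _)) as [_ [_ H]].
    split; eapply (ex_series_le (K := R_AbsRing) (V := R_CompleteNormedModule));
      try apply ex_series_exp_coef; intros n; apply (H n). }
  assert (cvn : forall r, CVN_r (fun n s => A s * v n s) r *
                          CVN_r (fun n s => B s * u n s) r).
  { intros r. destruct (bnd (r + Rabs a)) as [K HK].
    set (m := fun n => K * (C * (K * (r + Rabs a)) ^ n / INR (Factorial.fact n))).
    assert (Hm : ex_series m).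
    { apply (ex_series_scal (K := R_AbsRing) (V := R_NormedModule)), ex_series_exp_coef. }
    assert (near : forall t, Rabs t < r -> Rabs (t - a) <= r + Rabs a).
    { intros t Ht. pose proof (Rabs_triang t (- a)) as H.
      rewrite Rabs_Ropp in H. unfold Rminus. lra. }
    split; apply CVN_r_majorant with m; auto; intros n t Ht;
      destruct (HK t (near t Ht)) as [HA [HB H]]; rewrite Rabs_mult;
      (apply Rmult_le_compat; [apply Rabs_pos|apply Rabs_pos|assumption|apply H]). }
  exists (fun t => x0 + Series (fun n => u (S n) t)),
         (fun t => y0 + Series (fun n => v (S n) t)).
  assert (split0 : forall t, Series (fun n => u n t) = x0 + Series (fun n => u (S n) t)
      /\ Series (fun n => v n t) = y0 + Series (fun n => v (S n) t)).
  { intros t. split.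
    - exact (Series_incr_1 (fun n => u n t) (proj1 (sum t))).
    - exact (Series_incr_1 (fun n => v n t) (proj2 (sum t))). }
  split; [|split; [|split]].
  - rewrite (Series_zero (fun n => u (S n) a)); [ring|]. intros n. apply RInt_empty.
  - rewrite (Series_zero (fun n => v (S n) a)); [ring|]. intros n. apply RInt_empty.
  - intros t. rewrite <- (proj2 (split0 t)). apply is_derive_Series_linear.
    + intros n s. unfold u. simpl.
      apply is_derive_RInt_continuous with (f := fun s => A s * v n s).
      intros z. apply (continuous_mult (K := R_AbsRing)); auto.
      now apply picard_continuous.
    + intros s. apply ex_series_incr_1 with (a := fun n => u n s). apply sum.
    + apply cvn.
  - intros t. rewrite <- (proj1 (split0 t)). apply is_derive_Series_linear.
    + intros n s. unfold v. simpl.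
      apply is_derive_RInt_continuous with (f := fun s => B s * u n s).
      intros z. apply (continuous_mult (K := R_AbsRing)); auto.
      now apply picard_continuous.
    + intros s. apply ex_series_incr_1 with (a := fun n => v n s). apply sum.
    + apply cvn.
Qed.

(** * Tail weights *)

(** Both sides vanish at [a], since [RInt B a a = 0], and have derivative
    [B (I - RInt A a)]: on the right the two terms in [RInt B a * A] cancel. *)
Lemma RInt_tail_parts (A B : R -> R) (a I t : R) :
  (forall s, continuous A s) -> (forall s, continuous B s) -> a <= t ->
  RInt (fun s => B s * (I - RInt A a s)) a t
  = RInt B a t * (I - RInt A a t) + RInt (fun s => RInt B a s * A s) a t.
Proof.
  intros cA cB Ht.
  pose (P := fun s => RInt A a s : R). pose (Q := fun s => RInt B a s : R).
  change (RInt (fun s => B s * (I - P s)) a t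
    = Q t * (I - P t) + RInt (fun s => Q s * A s) a t).
  assert (c1 : forall s, continuous (fun s => B s * (I - P s)) s).
  { intros s. apply (continuous_mult (K := R_AbsRing)); [apply cB|].
    apply (continuous_minus (V := R_NormedModule)); [apply continuous_const|].
    now apply continuous_RInt. }
  assert (c2 : forall s, continuous (fun s => Q s * A s) s).
  { intros s. apply (continuous_mult (K := R_AbsRing)); [|apply cA].
    now apply continuous_RInt. }
  pose (F := fun u => RInt (fun s => B s * (I - P s)) a u).
  pose (G := fun u => Q u * (I - P u) + RInt (fun s => Q s * A s) a u).
  assert (dF : forall s, is_derive F s (B s * (I - P s))).
  { intros s. exact (is_derive_RInt_continuous _ a s c1). }
  assert (dG : forall s, is_derive G s (B s * (I - P s))).
  { intros s.
    replace (B s * (I - P s)) with (B s * (I - P s) + Q s * (0 - A s) + Q s * A s)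
      by ring.
    apply (is_derive_plus (K := R_AbsRing) (V := R_NormedModule)).
    - apply (is_derive_product Q (fun u => I - P u)); [now apply is_derive_RInt_continuous|].
      apply (is_derive_minus (K := R_AbsRing) (V := R_NormedModule)).
      + exact (is_derive_const (K := R_AbsRing) (V := R_NormedModule) I s).
      + now apply is_derive_RInt_continuous.
    - exact (is_derive_RInt_continuous _ a s c2). }
  assert (H1 : F t - F a <= G t - G a)
    by (apply (derive_le_incr _ _ _ _ _ _ Ht dF dG); intros; lra).
  assert (H2 : G t - G a <= F t - F a)
    by (apply (derive_le_incr _ _ _ _ _ _ Ht dG dF); intros; lra).
  unfold F, G, Q, P in *. rewrite !RInt_empty in *. lra.
Qed.

(** Here [I - RInt A a t] is the integral of [A] over [t,oo).  After integration
    by parts the integral on the left exceeds the one on the right by a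
    nonnegative boundary term, which gives one implication.  For the other, with
    [P] and [Q] the integrals of [A] and [B] from [a], the integral of
    [B (I - P)] up to a fixed [t] is at most the integral of [Q A] up to a later
    [u] plus [Q t * (I - P u)], which vanishes as [u] grows. *)
Lemma RInt_diverges_tail_iff (A B : R -> R) (a I : R) :
  (forall t, continuous A t) -> (forall t, continuous B t) ->
  (forall t, a <= t -> 0 <= A t) -> (forall t, a <= t -> 0 <= B t) ->
  is_lim (fun t => RInt A a t) p_infty I ->
  RInt_diverges (fun t => B t * (I - RInt A a t)) a <->
  RInt_diverges (fun t => RInt B a t * A t) a.
Proof.
  intros cA cB pA pB HI.
  pose (P := fun s => RInt A a s : R). pose (Q := fun s => RInt B a s : R).
  assert (parts : forall t, a <= t -> RInt (fun s => B s * (I - P s)) a t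
    = Q t * (I - P t) + RInt (fun s => Q s * A s) a t).
  { intros t Ht. now apply RInt_tail_parts. }
  change (RInt_diverges (fun t => B t * (I - P t)) a <->
    RInt_diverges (fun t => Q t * A t) a).
  assert (Pinf : forall t, a <= t -> P t <= I).
  { intros t Ht. now apply RInt_le_limit. }
  assert (Q0 : Q a = 0) by apply RInt_empty.
  assert (Qpos : forall t, a <= t -> 0 <= Q t).
  { intros t Ht. rewrite <- Q0. apply RInt_continuous_incr; auto; lra. }
  assert (cQA : forall s, continuous (fun s => Q s * A s) s).
  { intros s. apply (continuous_mult (K := R_AbsRing)); [|apply cA].
    now apply continuous_RInt. }
  unfold RInt_diverges. split; intros H.
  - (* The 1 in [M + 1] pays for [Q t * (I - P u)], which is below 1 for late [u]. *)
    apply is_lim_spec. intros M. apply is_lim_spec in H.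
    destruct (H (M + 1)) as [t0 Ht0].
    set (t := Rmax a t0 + 1).
    assert (Hta : a <= t) by (unfold t; pose proof (Rmax_l a t0); lra).
    assert (Htt : t0 < t) by (unfold t; pose proof (Rmax_r a t0); lra).
    specialize (Ht0 t Htt). rewrite parts in Ht0 by exact Hta.
    assert (Hlim : is_lim (fun u => Q t * (I - P u)) p_infty 0).
    { replace (Finite 0) with (Rbar_mult (Q t) (Finite (I - I)))
        by (simpl; f_equal; ring).
      apply is_lim_scal_l.
      apply (is_lim_minus' (fun _ => I) P p_infty I I).
      - apply is_lim_const.
      - exact HI. }
    apply is_lim_spec in Hlim. destruct (Hlim (mkposreal 1 Rlt_0_1)) as [t1 Ht1].
    exists (Rmax t t1). intros u Hu.
    assert (Hut : t <= u) by (pose proof (Rmax_l t t1); lra).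
    assert (Hut1 : t1 < u) by (pose proof (Rmax_r t t1); lra).
    specialize (Ht1 u Hut1). simpl in Ht1. apply Rabs_lt_between in Ht1.
    (* [Q >= Q t] on [t,u] bounds [int_t^u Q A] below by [Q t (P u - P t)]. *)
    assert (K : Q t * P u - Q t * P t <=
       RInt (fun s => Q s * A s) a u - RInt (fun s => Q s * A s) a t).
    { apply (derive_le_incr (fun u => Q t * P u) (fun u => Q t * A u) _
        (fun s => Q s * A s) t u Hut).
      - intros s. apply (is_derive_scal (fun u => P u)).
        now apply is_derive_RInt_continuous.
      - intros s. exact (is_derive_RInt_continuous _ a s cQA).
      - intros s Hs. apply Rmult_le_compat_r; [apply pA; lra|].
        apply RInt_continuous_incr; auto; lra. }
    lra.
  - apply is_lim_le_p_loc with (2 := H). exists a. intros t Ht.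
    rewrite parts by lra.
    pose proof (Pinf t (Rlt_le _ _ Ht)). pose proof (Qpos t (Rlt_le _ _ Ht)).
    nra.
Qed.

Lemma is_lim_RInt_gen (f A : R -> R) (a I : R) :
  (forall s, a <= s -> A s = f s) ->
  is_RInt_gen f (at_point a) (Rbar_locally p_infty) I ->
  is_lim (fun t => RInt A a t) p_infty I.
Proof.
  intros HA HI U HU. destruct (HI U HU) as [V W HV [m HW] H].
  exists (Rmax a m). intros t Ht.
  assert (Hat : a < t) by (pose proof (Rmax_l a m); lra).
  assert (Hmt : m < t) by (pose proof (Rmax_r a m); lra).
  destruct (H a t HV (HW t Hmt)) as [y [Hy Uy]]. simpl in Hy.
  rewrite (RInt_ext A f a t).
  - now rewrite (is_RInt_unique _ _ _ _ Hy).
  - intros s Hs. rewrite Rmin_left in Hs by lra. apply HA. lra.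
Qed.

(** The improper integral from [t] splits as the one from [t] back to [a] plus
    the one from [a] to infinity. *)
Lemma tail_int_eq (p A : R -> R) (a t I : R) :
  (forall s, continuous A s) -> (forall s, a <= s -> A s = / p s) ->
  is_RInt_gen (fun s => / p s) (at_point a) (Rbar_locally p_infty) I -> a <= t ->
  tail_int p t = I - RInt A a t.
Proof.
  intros cA HA HI Ht. unfold tail_int.
  apply is_RInt_gen_unique.
  replace (I - RInt A a t) with (- RInt A a t + I)
    by ring.
  apply (is_RInt_gen_Chasles (V := R_NormedModule) _ a (- RInt A a t) I);
    [|exact HI].
  apply is_RInt_gen_at_point, (is_RInt_swap (V := R_NormedModule) _ t a (RInt A a t)).
  apply is_RInt_ext with A.
  - intros s Hs. rewrite Rmin_left in Hs by lra. apply HA. lra.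
  - apply (RInt_correct (V := R_CompleteNormedModule)), ex_RInt_continuous.
    intros; apply cA.
Qed.

(** * Growth of the normalised solution *)

(** The sign of [x y] is the quantity to control first: its derivative is a
    sum of squares with nonnegative weights, whatever the signs of [x] and [y],
    and it makes [x^2] nondecreasing. *)
Lemma system_lower_bounds (A B x y : R -> R) (a : R) :
  (forall t, continuous A t) -> (forall t, continuous B t) ->
  (forall t, a <= t -> 0 <= A t) -> (forall t, a <= t -> 0 <= B t) ->
  x a = 1 -> y a = 0 ->
  (forall t, is_derive x t (A t * y t)) ->
  (forall t, is_derive y t (B t * x t)) ->
  forall t, a <= t ->
  1 <= x t /\ RInt B a t <= y t /\ RInt (fun s => RInt B a s * A s) a t <= x t.
Proof.
  intros cA cB pA pB xa ya dx dy.
  assert (d0 : forall s, is_derive (fun _ : R => 0) s 0).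
  { intros s. exact (is_derive_const (K := R_AbsRing) (V := R_NormedModule) 0 s). }
  assert (cQA : forall s, continuous (fun s => RInt B a s * A s) s).
  { intros s. apply (continuous_mult (K := R_AbsRing)); [|apply cA].
    now apply continuous_RInt. }
  assert (Hxy : forall t, a <= t -> 0 <= x t * y t).
  { intros t Ht.
    assert (H : 0 - 0 <= x t * y t - x a * y a).
    { apply (derive_le_incr (fun _ => 0) (fun _ => 0) (fun t => x t * y t)
        (fun s => A s * y s * y s + x s * (B s * x s)) a t Ht d0).
      - intros s. now apply is_derive_product.
      - intros s Hs. pose proof (pA s Hs). pose proof (pB s Hs).
        pose proof (Rle_0_sqr (x s)). pose proof (Rle_0_sqr (y s)).
        unfold Rsqr in *. nra. }
    rewrite ya in H. lra. }
  assert (Hx2 : forall t, a <= t -> 1 <= x t * x t).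
  { intros t Ht.
    assert (H : 0 - 0 <= x t * x t - x a * x a).
    { apply (derive_le_incr (fun _ => 0) (fun _ => 0) (fun t => x t * x t)
        (fun s => A s * y s * x s + x s * (A s * y s)) a t Ht d0).
      - intros s. now apply is_derive_product.
      - intros s Hs. pose proof (pA s Hs). pose proof (Hxy s Hs). nra. }
    rewrite xa in H. lra. }
  assert (Hx : forall t, a <= t -> 1 <= x t).
  { intros t Ht. destruct (Rle_or_lt 0 (x t)) as [H|H].
    - pose proof (Hx2 t Ht). nra.
    - (* A negative value would force a zero of [x], where [x^2 >= 1] fails. *)
      exfalso.
      destruct (IVT_gen_consistent x a t 0) as [c [Hc E]].
      + intros s. exact (is_derive_continuous _ _ _ (dx s)).
      + rewrite xa, Rmin_right, Rmax_left; lra.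
      + rewrite Rmin_left in Hc by lra.
        pose proof (Hx2 c (proj1 Hc)) as Hc2. rewrite E in Hc2. lra. }
  assert (Hy : forall t, a <= t -> RInt B a t <= y t).
  { intros t Ht.
    assert (H : RInt B a t - RInt B a a <= y t - y a).
    { apply (derive_le_incr (fun u => RInt B a u) B y (fun s => B s * x s) a t Ht).
      - intros s. now apply is_derive_RInt_continuous.
      - exact dy.
      - intros s Hs. pose proof (pB s Hs). pose proof (Hx s Hs). nra. }
    rewrite RInt_empty, ya in H. lra. }
  intros t Ht. split; [now apply Hx|]. split; [now apply Hy|].
  assert (H : RInt (fun s => RInt B a s * A s) a t - RInt (fun s => RInt B a s * A s) a a
     <= x t - x a).
  { apply (derive_le_incr (fun u => RInt (fun s => RInt B a s * A s) a u)
       (fun s => RInt B a s * A s) x (fun s => A s * y s) a t Ht).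
    - intros s. exact (is_derive_RInt_continuous _ a s cQA).
    - exact dx.
    - intros s Hs. rewrite Rmult_comm.
      apply Rmult_le_compat_l; [now apply pA | now apply Hy]. }
  rewrite RInt_empty, xa in H. lra.
Qed.

(** * From the half-line to the real line *)

(** A point [s] to which [within D (locally t)] converges must be [t] itself,
    because [t] lies in [D]; this reduces the relative derivative to the usual
    one. *)
Lemma is_derive_within_ext (D : R -> Prop) (f g : R -> R) (t l : R) :
  D t -> (forall s, D s -> f s = g s) -> is_derive g t l ->
  is_derive_within D f t l.
Proof.
  intros Dt Hfg [Hl Hd]. split; [exact Hl|].
  intros s Hs.
  assert (E : t = s).
  { apply (eq_close (K := R_AbsRing) (V := R_NormedModule)). intros eps. apply ball_sym.
    exact (locally_singleton _ _ (Hs _ (locally_ball s eps)) Dt). }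
  subst s.
  intros eps. unfold within.
  apply filter_imp with (2 := Hd t (fun P HP => HP) eps).
  intros s Hs' Ds. now rewrite (Hfg s Ds), (Hfg t Dt).
Qed.

(** [Rmax a] retracts the real line continuously onto [a,oo), so one-sided
    continuity at [a] is enough. *)
Lemma continuous_clamp_left (f : R -> R) (a t : R) :
  continuous_on (half_line a) f -> continuous (fun s => f (Rmax a s)) t.
Proof.
  intros H.
  assert (Hm : a <= Rmax a t) by apply Rmax_l.
  apply (filterlim_comp _ _ _ (fun s => Rmax a s) f (locally t)
    (within (half_line a) (locally (Rmax a t))) (locally (f (Rmax a t)))).
  - intros U HU. unfold within in HU.
    assert (c : continuous (fun s => Rmax a s) t).
    { apply filterlim_locally. intros eps. exists eps. intros s Hs.
      apply Rabs_lt_between in Hs. apply Rabs_lt_between.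
      revert Hs. unfold minus, plus, opp; simpl.
      pose proof (cond_pos eps).
      apply (Rmax_case_strong a s); apply (Rmax_case_strong a t); intros; lra. }
    specialize (c _ HU). unfold filtermap in *.
    apply filter_imp with (2 := c). intros s Hs. apply Hs. apply Rmax_l.
  - apply H, Hm.
Qed.

Theorem theorem4p6 (a : R) (p q : R -> R)
  (ha : 0 <= a)
  (hp : forall t, a <= t -> 0 < p t)
  (hq : forall t, a <= t -> 0 < q t)
  (cp : continuous_on (half_line a) p)
  (cq : continuous_on (half_line a) q)
  (Ip : ex_RInt_gen (fun t => / p t) (at_point a) (Rbar_locally p_infty))
  (Iq : RInt_diverges q a) :
  (RInt_diverges (fun t => q t * tail_int p t) a <->
   RInt_diverges (fun t => QQ q a t / p t) a) /\
  (RInt_diverges (fun t => q t * tail_int p t) a ->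
   forall delta : R, 0 < delta < 1 ->
   Rbar_locally p_infty
     (fun t => RInt (fun s => QQ q a s ^ 2 / p s) a t <= delta * QQ q a t) ->
   exists (T : R) (x x' : R -> R),
     is_solution a p q T x x' /\
     (forall t, T <= t -> 0 < x t) /\
     is_growing_extreme p x x' /\
     is_lim x p_infty p_infty /\
     is_lim (quasi_deriv p x') p_infty p_infty).
Proof.
  set (A := fun t => / p (Rmax a t)).
  set (B := fun t => q (Rmax a t)).
  assert (eA : forall t, a <= t -> A t = / p t)
    by (intros t Ht; unfold A; now rewrite Rmax_right).
  assert (eB : forall t, a <= t -> B t = q t)
    by (intros t Ht; unfold B; now rewrite Rmax_right).
  assert (cA : forall t, continuous A t).
  { intros t. unfold A.
    apply continuous_comp with (g := Rinv) (f := fun t => p (Rmax a t)).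
    - now apply continuous_clamp_left.
    - apply continuous_Rinv. apply Rgt_not_eq, hp, Rmax_l. }
  assert (cB : forall t, continuous B t) by (intros t; now apply continuous_clamp_left).
  assert (pA : forall t, a <= t -> 0 <= A t).
  { intros t Ht. rewrite (eA t Ht). left. now apply Rinv_0_lt_compat, hp. }
  assert (pB : forall t, a <= t -> 0 <= B t).
  { intros t Ht. rewrite (eB t Ht). left. now apply hq. }
  destruct Ip as [I HI].
  pose proof (is_lim_RInt_gen _ A a I eA HI) as HP.
  assert (eQ : forall t, a <= t -> RInt B a t = QQ q a t).
  { intros t Ht. apply RInt_ext. intros s Hs. rewrite Rmin_left in Hs by lra.
    apply eB. lra. }
  assert (div_ext : forall f g : R -> R, (forall t, a <= t -> f t = g t) ->
            RInt_diverges f a -> RInt_diverges g a).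
  { intros f g E H. apply is_lim_ext_loc with (2 := H).
    exists a. intros t Ht. apply RInt_ext. intros s Hs.
    rewrite Rmin_left in Hs by lra. apply E. lra. }
  assert (eL : forall t, a <= t ->
            B t * (I - RInt A a t) = q t * tail_int p t).
  { intros t Ht. rewrite (tail_int_eq p A a t I); auto. now rewrite eB. }
  assert (eR : forall t, a <= t -> RInt B a t * A t = QQ q a t / p t).
  { intros t Ht. rewrite (eQ t Ht), (eA t Ht). reflexivity. }
  assert (Hiff : RInt_diverges (fun t => q t * tail_int p t) a <->
                 RInt_diverges (fun t => QQ q a t / p t) a).
  { pose proof (RInt_diverges_tail_iff A B a I cA cB pA pB HP) as [H1 H2].
    split; intros H.
    - apply (div_ext _ _ eR), H1. apply div_ext with (2 := H).
      intros t Ht. symmetry. now apply eL.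
    - apply (div_ext _ _ eL), H2. apply div_ext with (2 := H).
      intros t Ht. symmetry. now apply eR. }
  split; [exact Hiff|].
  intros Hdiv delta _ _. apply Hiff in Hdiv.
  destruct (linear_system_solution A B a 1 0 cA cB) as [x [y [xa [ya [dx dy]]]]].
  pose proof (system_lower_bounds A B x y a cA cB pA pB xa ya dx dy) as low.
  (* [A t * y t], not [y t / p t]: it is the two-sided derivative of [x] on all
     of R, whereas [p] is arbitrary to the left of [a]. *)
  exists a, x, (fun t => A t * y t).
  assert (eD : forall t, a <= t -> quasi_deriv p (fun t => A t * y t) t = y t).
  { intros t Ht. unfold quasi_deriv. rewrite (eA t Ht). field.
    apply Rgt_not_eq, hp, Ht. }
  assert (Lx : is_lim x p_infty p_infty).
  { apply is_lim_le_p_loc with (2 := Hdiv). exists a. intros t Ht.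
    rewrite <- (RInt_ext (fun s => RInt B a s * A s)).
    - apply low. lra.
    - intros s Hs. rewrite Rmin_left in Hs by lra. apply eR. lra. }
  assert (Ly : is_lim (quasi_deriv p (fun t => A t * y t)) p_infty p_infty).
  { apply is_lim_le_p_loc with (2 := Iq). exists a. intros t Ht.
    rewrite eD by lra. change (RInt q a t) with (QQ q a t).
    rewrite <- eQ by lra. apply low. lra. }
  split; [|split; [|split; [|split]]]; auto.
  - split; [lra|]. split; [|split].
    + intros t Ht. now apply is_derive_within_ext with x.
    + intros t Ht. apply is_derive_within_ext with y; auto.
      rewrite <- (eB t Ht). apply dy.
    + exists a. rewrite xa. lra.
  - intros t Ht. destruct (low t Ht). lra.
  - exists p_infty, p_infty. auto.
Qed.
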